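(* Let $K$ be a field and let $\mathcal{G}=(G^0,\mathcal{G}^1,r,s)$ be an ultragraph without sinks. Then the ultragraph Leavitt path algebra $L_K(\mathcal{G})$ is simple if the following three conditions hold: (1) $\mathcal{G}$ satisfies Condition (K); (2) every vertex connects to every infinite path; (3) if $A\in\mathcal{G}^0$ is an infinite emitter, then for every $v\in G^0$ there exists a finite path $\alpha\in\mathcal{G}^*$ such that $s(\alpha)=v$ and $A\subseteq r(\alpha)$.
   Context: An ultragraph $\mathcal{G}=(G^0,\mathcal{G}^1,r,s)$ consists of a countable set $G^0$ of vertices, a countable set $\mathcal{G}^1$ of edges, and maps $s:\mathcal{G}^1\to G^0$, $r:\mathcal{G}^1\to\mathcal{P}(G^0)\setminus\{\varnothing\}$. A vertex $v$ is a sink if $s^{-1}(v)=\varnothing$, and regular if $0<|s^{-1}(v)|<\infty$. $\mathcal{G}^0$ is the smallest subset of $\mathcal{P}(G^0)$ containing all $\{v\}$ and all $r(e)$ and closed under finite unions and finite intersections. A set $A\in\mathcal{G}^0$ is an infinite emitter if $\{e\in\mathcal{G}^1: s(e)\in A\}$ is infinite. A finite path is either an element $A\in\mathcal{G}^0$ (length $0$, $s(A)=r(A)=A$; the path $\{v\}$ is regarded as having source $v$) or a sequence $\alpha=e_1\cdots e_n$ of edges with $s(e_{i+1})\in r(e_i)$ (length $n$, $s(\alpha)=s(e_1)$, $r(\alpha)=r(e_n)$); $\mathcal{G}^*$ is the set of finite paths. An infinite path is a sequence $e_1e_2\cdots$ of edges with $s(e_{i+1})\in r(e_i)$ for all $i\ge1$.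 For vertices $v,w\in G^0$ write $w\ge v$ if there is $\alpha\in\mathcal{G}^*$ with $s(\alpha)=w$ and $v\in r(\alpha)$. A vertex $v$ connects to an infinite path $e_1e_2\cdots$ if $v\ge s(e_i)$ for some $i$. A cycle based at $v$ is a path $c=e_1\cdots e_n$ with $n\ge1$, $s(c)=v$ and $v\in r(c)$; it is a first-return path based at $v$ if moreover $s(e_i)\ne v$ for all $i\ge2$. $\mathcal{G}$ satisfies Condition (K) if every vertex is either the base of no first-return path or the base of at least two first-return paths. $L_K(\mathcal{G})$ is the $K$-algebra generated by $\{s_e,s_e^*: e\in\mathcal{G}^1\}\cup\{p_A: A\in\mathcal{G}^0\}$ subject to, for all $A,B\in\mathcal{G}^0$, $e,f\in\mathcal{G}^1$: (1) $p_\varnothing=0$, $p_Ap_B=p_{A\cap B}$, $p_{A\cup B}=p_A+p_B-p_{A\cap B}$; (2) $p_{s(e)}s_e=s_e=s_ep_{r(e)}$ and $p_{r(e)}s_e^*=s_e^*=s_e^*p_{s(e)}$; (3) $s_e^*s_f=\delta_{e,f}p_{r(e)}$; (4) $p_v=\sum_{s(e)=v}s_es_e^*$ for every regular vertex $v$ (with $p_v:=p_{\{v\}}$). Simple means having no nontrivial two-sided ideals. *)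

(* Defs.v *)
From HB Require Import structures.
From mathcomp Require Import all_boot all_algebra generic_quotient finmap.
From mathcomp Require Import all_classical.

Set Implicit Arguments.
Unset Strict Implicit.
Unset Printing Implicit Defensive.

Import GRing.Theory.
Local Open Scope classical_set_scope.
Local Open Scope ring_scope.

(* Associative K-algebras, not assumed to have a unit: MathComp's algebras are
   all unital, whereas a Leavitt path algebra usually is not. *)
HB.mixin Record Lmodule_isNuAlgebra (K : pzRingType) A of GRing.Lmodule K A := {
  numul : A -> A -> A;
  numulA : associative numul;
  numulDl : left_distributive numul +%R;
  numulDr : right_distributive numul +%R;
  numulZl : forall (k : K) x y, numul (k *: x) y = k *: numul x y;
  numulZr : forall (k : K) x y, numul x (k *: y) = k *: numul x y
}.

#[short(type="nuAlgType")]
HB.structure Definition NuAlgebra (K : pzRingType) :=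
  {A of GRing.Lmodule K A & Lmodule_isNuAlgebra K A}.

(* An ideal of the underlying ring: stability under scalars is not required. *)
Definition two_sided_ideal (K : pzRingType) (A : nuAlgType K) (I : set A) :=
  [/\ I 0,
      forall x y, I x -> I y -> I (x - y),
      forall a x, I x -> I (numul a x)
    & forall a x, I x -> I (numul x a)].

Definition simple_algebra (K : pzRingType) (A : nuAlgType K) :=
  forall I : set A, two_sided_ideal I -> I = [set 0] \/ I = setT.

(* The non-unital associative K-algebra presented by generators X and relations
   R: formal expressions over X, modulo the least congruence which contains R
   and the axioms of non-unital K-algebras.  Its universal property is
   [presented_lift] and [presented_lift_unique] below. *)
Inductive nuterm (K X : Type) : Type :=
| TGen of X
| TZero
| TOpp of nuterm K X
| TAdd of nuterm K X & nuterm K X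
| TScale of K & nuterm K X
| TMul of nuterm K X & nuterm K X.
Arguments TGen {K X}.
Arguments TZero {K X}.

HB.instance Definition _ (K X : Type) := gen_eqMixin (nuterm K X).
HB.instance Definition _ (K X : Type) := gen_choiceMixin (nuterm K X).

Definition TSum (K X : Type) (ts : seq (nuterm K X)) : nuterm K X :=
  foldr (@TAdd K X) TZero ts.

Inductive nucong (K : pzRingType) (X : Type)
    (R : nuterm K X -> nuterm K X -> Prop) :
    nuterm K X -> nuterm K X -> Prop :=
| nc_rel t u : R t u -> nucong R t u
| nc_refl t : nucong R t t
| nc_sym t u : nucong R t u -> nucong R u t
| nc_trans t u v : nucong R t u -> nucong R u v -> nucong R t v
| nc_opp t t' : nucong R t t' -> nucong R (TOpp t) (TOpp t')
| nc_add t t' u u' : nucong R t t' -> nucong R u u' ->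
    nucong R (TAdd t u) (TAdd t' u')
| nc_scale k t t' : nucong R t t' -> nucong R (TScale k t) (TScale k t')
| nc_mul t t' u u' : nucong R t t' -> nucong R u u' ->
    nucong R (TMul t u) (TMul t' u')
| nc_addA t u v : nucong R (TAdd t (TAdd u v)) (TAdd (TAdd t u) v)
| nc_addC t u : nucong R (TAdd t u) (TAdd u t)
| nc_add0 t : nucong R (TAdd TZero t) t
| nc_addN t : nucong R (TAdd (TOpp t) t) TZero
| nc_scaleA k l t : nucong R (TScale k (TScale l t)) (TScale (k * l) t)
| nc_scale1 t : nucong R (TScale 1 t) t
| nc_scaleDr k t u :
    nucong R (TScale k (TAdd t u)) (TAdd (TScale k t) (TScale k u))
| nc_scaleDl k l t :
    nucong R (TScale (k + l) t) (TAdd (TScale k t) (TScale l t))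
| nc_mulA t u v : nucong R (TMul t (TMul u v)) (TMul (TMul t u) v)
| nc_mulDl t u v : nucong R (TMul (TAdd t u) v) (TAdd (TMul t v) (TMul u v))
| nc_mulDr t u v : nucong R (TMul t (TAdd u v)) (TAdd (TMul t u) (TMul t v))
| nc_mulZl k t u : nucong R (TMul (TScale k t) u) (TScale k (TMul t u))
| nc_mulZr k t u : nucong R (TMul t (TScale k u)) (TScale k (TMul t u)).

Section Presented.
Variables (K : pzRingType) (X : Type) (R : nuterm K X -> nuterm K X -> Prop).

Definition nucongb : rel (nuterm K X) := fun t u => `[< nucong R t u >].

Lemma nucongb_refl : reflexive nucongb.
Proof. by move=> t; apply/asboolP; exact: nc_refl. Qed.

Lemma nucongb_sym : symmetric nucongb.
Proof. by move=> t u; apply/asboolP/asboolP; exact: nc_sym. Qed.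

Lemma nucongb_trans : transitive nucongb.
Proof.
by move=> u t v /asboolP tu /asboolP uv; apply/asboolP; exact: nc_trans uv.
Qed.

Canonical nucong_equiv :=
  EquivRel nucongb nucongb_refl nucongb_sym nucongb_trans.

Definition presented : Type := {eq_quot nucong_equiv}%qT.

HB.instance Definition _ := Choice.on presented.
HB.instance Definition _ := EqQuotient.on presented.

Local Notation cl t := (\pi_presented t)%qT.

Lemma presentedP t u : cl t = cl u <-> nucong R t u.
Proof.
split=> [/eqP|tu]; first by rewrite eqmodE => /asboolP.
by apply/eqP; rewrite eqmodE; apply/asboolP.
Qed.

Lemma repr_cong t : nucong R (repr (cl t)) t.
Proof. by apply/presentedP; rewrite reprK. Qed.

(* Locked, so that rewriting with [p_piE] does not unfold them. *)
Definition padd : presented -> presented -> presented :=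
  locked (fun x y => cl (TAdd (repr x) (repr y))).
Definition popp : presented -> presented := locked (fun x => cl (TOpp (repr x))).
Definition pscale : K -> presented -> presented :=
  locked (fun k x => cl (TScale k (repr x))).
Definition pmul : presented -> presented -> presented :=
  locked (fun x y => cl (TMul (repr x) (repr y))).
Definition pgen (x : X) : presented := cl (TGen x).

Lemma padd_pi t u : padd (cl t) (cl u) = cl (TAdd t u).
Proof. by rewrite /padd -lock; apply/presentedP/nc_add; exact: repr_cong. Qed.

Lemma popp_pi t : popp (cl t) = cl (TOpp t).
Proof. by rewrite /popp -lock; apply/presentedP/nc_opp; exact: repr_cong. Qed.

Lemma pscale_pi k t : pscale k (cl t) = cl (TScale k t).
Proof. by rewrite /pscale -lock; apply/presentedP/nc_scale; exact: repr_cong. Qed.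

Lemma pmul_pi t u : pmul (cl t) (cl u) = cl (TMul t u).
Proof. by rewrite /pmul -lock; apply/presentedP/nc_mul; exact: repr_cong. Qed.

Definition p_piE := (padd_pi, popp_pi, pscale_pi, pmul_pi).

Fact paddA : associative padd.
Proof.
elim/quotW=> t; elim/quotW=> u; elim/quotW=> v; rewrite !p_piE.
by apply/presentedP; exact: nc_addA.
Qed.

Fact paddC : commutative padd.
Proof.
elim/quotW=> t; elim/quotW=> u; rewrite !p_piE.
by apply/presentedP; exact: nc_addC.
Qed.

Fact padd0 : left_id (cl TZero) padd.
Proof.
by elim/quotW=> t; rewrite !p_piE; apply/presentedP; exact: nc_add0.
Qed.

Fact paddN : left_inverse (cl TZero) popp padd.
Proof.
by elim/quotW=> t; rewrite !p_piE; apply/presentedP; exact: nc_addN.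
Qed.

HB.instance Definition _ :=
  GRing.isZmodule.Build presented paddA paddC padd0 paddN.

Fact pscaleA k l x : pscale k (pscale l x) = pscale (k * l) x.
Proof.
by elim/quotW: x => t; rewrite !p_piE; apply/presentedP; exact: nc_scaleA.
Qed.

Fact pscale1 : left_id 1 pscale.
Proof.
by elim/quotW=> t; rewrite !p_piE; apply/presentedP; exact: nc_scale1.
Qed.

Fact pscaleDr : right_distributive pscale +%R.
Proof.
move=> k; elim/quotW=> t; elim/quotW=> u; rewrite /GRing.add /= !p_piE.
by apply/presentedP; exact: nc_scaleDr.
Qed.

Fact pscaleDl x : {morph pscale^~ x : k l / k + l}.
Proof.
move=> k l; elim/quotW: x => t; rewrite [RHS]/GRing.add /= !p_piE.
by apply/presentedP; exact: nc_scaleDl.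
Qed.

HB.instance Definition _ := GRing.Zmodule_isLmodule.Build K presented
  pscaleA pscale1 pscaleDr pscaleDl.

Fact pmulA : associative pmul.
Proof.
elim/quotW=> t; elim/quotW=> u; elim/quotW=> v; rewrite !p_piE.
by apply/presentedP; exact: nc_mulA.
Qed.

Fact pmulDl : left_distributive pmul +%R.
Proof.
elim/quotW=> t; elim/quotW=> u; elim/quotW=> v; rewrite /GRing.add /= !p_piE.
by apply/presentedP; exact: nc_mulDl.
Qed.

Fact pmulDr : right_distributive pmul +%R.
Proof.
elim/quotW=> t; elim/quotW=> u; elim/quotW=> v; rewrite /GRing.add /= !p_piE.
by apply/presentedP; exact: nc_mulDr.
Qed.

Fact pmulZl (k : K) (x y : presented) : pmul (k *: x) y = k *: pmul x y.
Proof.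
elim/quotW: x => t; elim/quotW: y => u; rewrite /GRing.scale /= !p_piE.
by apply/presentedP; exact: nc_mulZl.
Qed.

Fact pmulZr (k : K) (x y : presented) : pmul x (k *: y) = k *: pmul x y.
Proof.
elim/quotW: x => t; elim/quotW: y => u; rewrite /GRing.scale /= !p_piE.
by apply/presentedP; exact: nc_mulZr.
Qed.

HB.instance Definition _ := Lmodule_isNuAlgebra.Build K presented
  pmulA pmulDl pmulDr pmulZl pmulZr.

Section UniversalProperty.
Variables (B : nuAlgType K) (g : X -> B).

Fixpoint nueval (t : nuterm K X) : B :=
  match t with
  | TGen x => g x
  | TZero => 0
  | TOpp t => - nueval t
  | TAdd t u => nueval t + nueval u
  | TScale k t => k *: nueval t
  | TMul t u => numul (nueval t) (nueval u)
  end.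

Lemma nueval_cong : (forall t u, R t u -> nueval t = nueval u) ->
  forall t u, nucong R t u -> nueval t = nueval u.
Proof.
move=> gR t u; elim=> {t u} /=.
- exact: gR.
- by [].
- by [].
- by move=> t u v _ -> _ ->.
- by move=> t t' _ ->.
- by move=> t t' u u' _ -> _ ->.
- by move=> k t t' _ ->.
- by move=> t t' u u' _ -> _ ->.
- by move=> *; rewrite addrA.
- by move=> *; rewrite addrC.
- by move=> *; rewrite add0r.
- by move=> *; rewrite addNr.
- by move=> *; rewrite scalerA.
- by move=> *; rewrite scale1r.
- by move=> *; rewrite scalerDr.
- by move=> *; rewrite scalerDl.
- by move=> *; rewrite numulA.
- by move=> *; rewrite numulDl.
- by move=> *; rewrite numulDr.
- by move=> *; rewrite numulZl.
- by move=> *; rewrite numulZr.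
Qed.

Lemma presented_lift : (forall t u, R t u -> nueval t = nueval u) ->
  exists f : presented -> B,
    [/\ linear f, {morph f : x y / numul x y} & forall x, f (pgen x) = g x].
Proof.
move=> /nueval_cong gR; pose f (x : presented) := nueval (repr x).
have fE t : f (cl t) = nueval t by apply: gR; exact: repr_cong.
exists f; split=> [k||x]; last by rewrite fE.
  elim/quotW=> t; elim/quotW=> u.
  by rewrite /GRing.scale /GRing.add /= !p_piE !fE.
elim/quotW=> t; elim/quotW=> u.
by rewrite [in LHS]/numul /= !p_piE !fE.
Qed.

Lemma presented_lift_unique (f f' : presented -> B) :
  linear f -> {morph f : x y / numul x y} ->
  linear f' -> {morph f' : x y / numul x y} ->
  (forall x, f (pgen x) = f' (pgen x)) -> f =1 f'.
Proof.
move=> lf mf lf' mf' ff'.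
have D (h : presented -> B) : linear h -> {morph h : x y / x + y} => [lh x y|].
  by have := lh 1 x y; rewrite !scale1r.
have Z (h : presented -> B) : linear h -> h 0 = 0 => [lh|].
  by apply: (addrI (h 0)); rewrite -(D _ lh) !addr0.
have S (h : presented -> B) : linear h -> forall k x, h (k *: x) = k *: h x => [lh k x|].
  by have := lh k x 0; rewrite (Z _ lh) !addr0.
elim/quotW; elim=> [x||t IH|t IHt u IHu|k t IH|t IHt u IHu].
- exact: ff'.
- by rewrite -[cl TZero]/(0 : presented) (Z _ lf) (Z _ lf').
- rewrite -popp_pi -[popp _]/(- (cl t : presented)) -scaleN1r.
  by rewrite (S _ lf) (S _ lf') IH.
- rewrite -padd_pi -[padd _ _]/((cl t : presented) + cl u).
  by rewrite (D _ lf) (D _ lf') IHt IHu.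
- rewrite -pscale_pi -[pscale _ _]/(k *: (cl t : presented)).
  by rewrite (S _ lf) (S _ lf') IH.
- rewrite -pmul_pi -[pmul _ _]/(numul (cl t : presented) (cl u)).
  by rewrite mf mf' IHt IHu.
Qed.

End UniversalProperty.
End Presented.

Record ultragraph := Ultragraph {
  vertex : countType;
  edge : countType;
  source : edge -> vertex;
  range : edge -> set vertex;
  range_nonempty : forall e, range e !=set0
}.
Arguments source {u}.
Arguments range {u}.

Section Ultragraph.
Variable G : ultragraph.
Implicit Types (v w : vertex G) (e f : edge G).

Definition is_sink v := source @^-1` [set v] = set0.

Definition regular v :=
  source @^-1` [set v] !=set0 /\ finite_set (source @^-1` [set v]).

(* The collection written with a calligraphic G and exponent 0.  The empty set
   is the empty union; it has to be a member for p_0 to make sense. *)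
Definition gensets : set (set (vertex G)) :=
  smallest [set M | [/\ M set0, setU_closed M & setI_closed M]]
    ([set [set v] | v in [set: vertex G]] `|` [set range e | e in [set: edge G]]).

Record genset := Genset { gset :> set (vertex G); gsetP : gensets gset }.

Lemma gensets0 : gensets set0.
Proof. by move=> M [[]]. Qed.

Lemma gensets1 v : gensets [set v].
Proof. by apply: sub_gen_smallest; left; exists v. Qed.

Lemma gensets_range e : gensets (range e).
Proof. by apply: sub_gen_smallest; right; exists e. Qed.

Lemma gensetsU : setU_closed gensets.
Proof.
move=> A B gA gB M MP; have [[_ MU _] _] := MP.
by apply: MU; [exact: gA|exact: gB].
Qed.

Lemma gensetsI : setI_closed gensets.
Proof.
move=> A B gA gB M MP; have [[_ _ MI] _] := MP.
by apply: MI; [exact: gA|exact: gB].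
Qed.

Definition gempty : genset := Genset gensets0.
Definition gvertex v : genset := Genset (gensets1 v).
Definition grange e : genset := Genset (gensets_range e).
Definition gunion (A B : genset) : genset := Genset (gensetsU (gsetP A) (gsetP B)).
Definition ginter (A B : genset) : genset := Genset (gensetsI (gsetP A) (gsetP B)).

Definition infinite_emitter (A : genset) := infinite_set (source @^-1` (A : set _)).

Definition follows e f : bool := `[< range e (source f) >].

(* [EdgePath e es _] is the path e_1 ... e_n with e_1 = e, [es] = e_2 ... e_n. *)
Inductive fin_path :=
| SetPath of genset
| EdgePath e (es : seq (edge G)) of path follows e es.

(* A vertex v is identified with the set [set v], so that "s(alpha) = v" reads
   [psource alpha = [set v]] for paths of any length. *)
Definition psource (alpha : fin_path) : set (vertex G) :=
  match alpha with SetPath A => A | EdgePath e _ _ => [set source e] end.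

Definition prange (alpha : fin_path) : set (vertex G) :=
  match alpha with SetPath A => A | EdgePath e es _ => range (last e es) end.

Definition infinite_path (p : nat -> edge G) :=
  forall i, range (p i) (source (p i.+1)).

(* w >= v *)
Definition reaches w v :=
  exists alpha : fin_path, psource alpha = [set w] /\ prange alpha v.

Definition connects v (p : nat -> edge G) := exists i, reaches v (source (p i)).

Definition cycle_at v (c : seq (edge G)) : Prop :=
  if c is e :: es then [/\ path follows e es, source e = v & range (last e es) v]
  else False.

Definition first_return v (c : seq (edge G)) : Prop :=
  cycle_at v c /\ (forall f, f \in behead c -> source f <> v).

Definition condition_K := forall v,
  (forall c, ~ first_return v c) \/
  (exists c d, [/\ c <> d, first_return v c & first_return v d]).

Inductive lpa_gen :=
| GenP of genset
| GenS of edge G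
| GenSstar of edge G.

Section LeavittPathAlgebra.
Variable K : pzRingType.

Local Notation p A := (@TGen K lpa_gen (GenP A)).
Local Notation s e := (@TGen K lpa_gen (GenS e)).
Local Notation sstar e := (@TGen K lpa_gen (GenSstar e)).

Inductive lpa_rel : nuterm K lpa_gen -> nuterm K lpa_gen -> Prop :=
| lpa_p0 : lpa_rel (p gempty) TZero
| lpa_pI A B : lpa_rel (TMul (p A) (p B)) (p (ginter A B))
| lpa_pU A B :
    lpa_rel (p (gunion A B)) (TAdd (TAdd (p A) (p B)) (TOpp (p (ginter A B))))
| lpa_ps e : lpa_rel (TMul (p (gvertex (source e))) (s e)) (s e)
| lpa_sp e : lpa_rel (TMul (s e) (p (grange e))) (s e)
| lpa_psstar e : lpa_rel (TMul (p (grange e)) (sstar e)) (sstar e)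
| lpa_sstarp e : lpa_rel (TMul (sstar e) (p (gvertex (source e)))) (sstar e)
| lpa_sstars e f :
    lpa_rel (TMul (sstar e) (s f)) (if e == f then p (grange e) else TZero)
| lpa_CK v : regular v ->
    lpa_rel (p (gvertex v))
      (TSum [seq TMul (s e) (sstar e) | e <- fset_set (source @^-1` [set v])]).

End LeavittPathAlgebra.
End Ultragraph.

Definition leavitt (K : pzRingType) (G : ultragraph) : nuAlgType K :=
  presented (@lpa_rel G K).

(* Main.v *)
(* A nonzero ideal I contains some p_v: given 0 <> x in I, multiplying x on
   the right by edges lowers its ghost degree until x is, up to a factor
   1 - sum_e s_e s_e^*, a combination of terms s_a p_A; one more edge f outside
   that finite sum makes it a nonzero combination of distinct paths s_a ending at
   one vertex w.  Cancelling a shortest a on the left leaves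
   p_w + (combination of nonempty paths), and Condition (K) supplies a cycle g at
   w, long and aperiodic, with s_g^* s_a s_g = 0 for each of these paths.

   Once p_v is in I, suppose p_A is not.  Then A is not an infinite emitter, by
   (3), so it is finite (no sinks) with regular vertices, and the Cuntz-Krieger
   relations give an edge e from A with p_{r(e)} not in I.  Iterating produces an
   infinite path all of whose sources avoid I, which contradicts (2). *)
From HB Require Import structures.
From mathcomp Require Import all_boot all_algebra finmap all_classical.
Require Import Defs.

Set Implicit Arguments.
Unset Strict Implicit.
Unset Printing Implicit Defensive.

Import GRing.Theory.
Local Open Scope classical_set_scope.

(** * Non-unital algebras and their ideals *)

Section NonUnitalAlgebra.
Local Open Scope ring_scope.
Variables (K : pzRingType) (A : nuAlgType K).
Implicit Types x y z : A.

Lemma numul0x x : numul 0 x = 0.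
Proof. by rewrite -{1}(scale0r (0 : A)) numulZl scale0r. Qed.

Lemma numulx0 x : numul x 0 = 0.
Proof. by rewrite -{1}(scale0r (0 : A)) numulZr scale0r. Qed.

Lemma numulNx x y : numul (- x) y = - numul x y.
Proof. by rewrite -scaleN1r numulZl scaleN1r. Qed.

Lemma numulxN x y : numul x (- y) = - numul x y.
Proof. by rewrite -scaleN1r numulZr scaleN1r. Qed.

Lemma numulBl x y z : numul (x - y) z = numul x z - numul y z.
Proof. by rewrite numulDl numulNx. Qed.

Lemma numulBr x y z : numul x (y - z) = numul x y - numul x z.
Proof. by rewrite numulDr numulxN. Qed.

Lemma numul_suml I (r : seq I) (P : pred I) (F : I -> A) y :
  numul (\sum_(i <- r | P i) F i) y = \sum_(i <- r | P i) numul (F i) y.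
Proof. by apply: (big_morph (numul^~ y) (fun u v => numulDl u v y)); exact: numul0x. Qed.

Lemma numul_sumr I (r : seq I) (P : pred I) (F : I -> A) x :
  numul x (\sum_(i <- r | P i) F i) = \sum_(i <- r | P i) numul x (F i).
Proof. by apply: (big_morph (numul x) (numulDr x)); exact: numulx0. Qed.

Section Ideal.
Variables (I : set A) (HI : two_sided_ideal I).

Lemma ideal0 : I 0. Proof. by case: HI. Qed.

Lemma idealB x y : I x -> I y -> I (x - y). Proof. by case: HI => _ + _ _; exact. Qed.

Lemma idealMl a x : I x -> I (numul a x). Proof. by case: HI => _ _ + _; exact. Qed.

Lemma idealMr a x : I x -> I (numul x a). Proof. by case: HI => _ _ _; exact. Qed.

Lemma idealN x : I x -> I (- x).
Proof. by move=> Ix; rewrite -sub0r; apply: idealB => //; exact: ideal0. Qed.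

Lemma idealD x y : I x -> I y -> I (x + y).
Proof. by move=> Ix Iy; rewrite -(opprK y); apply: idealB => //; exact: idealN. Qed.

Lemma ideal_sum T (r : seq T) (P : pred T) (F : T -> A) :
  (forall i, P i -> I (F i)) -> I (\sum_(i <- r | P i) F i).
Proof. by move=> IF; apply: big_ind => //; [exact: ideal0|exact: idealD]. Qed.

End Ideal.
End NonUnitalAlgebra.

(** * Finite sets of vertices as generalized vertices *)

Section GeneralizedVertices.
Variable G : ultragraph.
Implicit Types (A B : genset G) (v w : vertex G).

Lemma genset_eq A B : A = B :> set _ -> A = B.
Proof.
by case: A B => A gA [B gB] /= AB; rewrite AB in gA *; congr Genset; exact: Prop_irrelevance.
Qed.

Lemma set_consE (T : eqType) (x : T) (r : seq T) : [set` x :: r] = [set x] `|` [set` r].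
Proof.
apply/seteqP; split=> y /=; first by rewrite inE => /predU1P[]; [left|right].
by rewrite inE => -[->|->]; rewrite ?eqxx ?orbT.
Qed.

Lemma gensets_seq (r : seq (vertex G)) : gensets [set` r].
Proof.
elim: r => [|v r IH]; first by rewrite set_nil; exact: gensets0.
by rewrite set_consE; apply: gensetsU => //; exact: gensets1.
Qed.

Definition gseq (r : seq (vertex G)) : genset G := Genset (gensets_seq r).

End GeneralizedVertices.

(** * Leavitt families *)

(** Separates what the argument uses, namely the relations and generation, from the construction as
    a quotient of terms. *)
Record leavitt_family (K : pzRingType) (G : ultragraph) (L : nuAlgType K) := LeavittFamily {
  lf_p : genset G -> L;
  lf_s : edge G -> L;
  lf_sstar : edge G -> L;
  lf_p0 : lf_p (gempty G) = 0%R;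
  lf_pI : forall A B, numul (lf_p A) (lf_p B) = lf_p (ginter A B);
  lf_pU : forall A B, lf_p (gunion A B) = (lf_p A + lf_p B - lf_p (ginter A B))%R;
  lf_ps : forall e, numul (lf_p (gvertex (source e))) (lf_s e) = lf_s e;
  lf_sp : forall e, numul (lf_s e) (lf_p (grange e)) = lf_s e;
  lf_psstar : forall e, numul (lf_p (grange e)) (lf_sstar e) = lf_sstar e;
  lf_sstarp : forall e, numul (lf_sstar e) (lf_p (gvertex (source e))) = lf_sstar e;
  lf_sstars : forall e f, numul (lf_sstar e) (lf_s f) = if e == f then lf_p (grange e) else 0%R;
  lf_CK : forall v, regular v ->
    lf_p (gvertex v) = (\sum_(e <- fset_set (source @^-1` [set v])) numul (lf_s e) (lf_sstar e))%R;
  (* the family generates L *)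
  lf_ind : forall P : L -> Prop,
    (forall A, P (lf_p A)) -> (forall e, P (lf_s e)) -> (forall e, P (lf_sstar e)) ->
    P 0%R -> (forall x, P x -> P (- x)%R) -> (forall x y, P x -> P y -> P (x + y)%R) ->
    (forall k x, P x -> P (k *: x)%R) -> (forall x y, P x -> P y -> P (numul x y)) ->
    forall x, P x
}.

Lemma leavitt_canonical_family (K : pzRingType) (G : ultragraph) : leavitt_family G (leavitt K G).
Proof.
pose R := @lpa_rel G K.
pose cl (t : nuterm K (lpa_gen G)) : leavitt K G := (\pi_(presented R) t)%qT.
have clM t u : numul (cl t) (cl u) = cl (TMul t u) by rewrite -[LHS]/(pmul _ _) pmul_pi.
have clD t u : (cl t + cl u)%R = cl (TAdd t u) by rewrite -[LHS]/(padd _ _) padd_pi.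
have clN t : (- cl t)%R = cl (TOpp t) by rewrite -[LHS]/(popp _) popp_pi.
have clZ k t : (k *: cl t)%R = cl (TScale k t) by rewrite -[LHS]/(pscale _ _) pscale_pi.
have cl0 : 0%R = cl TZero by [].
have clS ts : cl (TSum ts) = (\sum_(t <- ts) cl t)%R.
  by elim: ts => [|t ts IH]; rewrite ?big_nil // big_cons -IH clD.
have clR t u : R t u -> cl t = cl u by move=> /nc_rel/presentedP.
apply: (@LeavittFamily _ _ _ (fun A => cl (TGen (GenP A))) (fun e => cl (TGen (GenS e)))
  (fun e => cl (TGen (GenSstar e)))).
- by rewrite cl0; apply: clR; exact: lpa_p0.
- by move=> A B; rewrite clM; apply: clR; exact: lpa_pI.
- by move=> A B; rewrite clN !clD; apply: clR; exact: lpa_pU.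
- by move=> e; rewrite clM; apply: clR; exact: lpa_ps.
- by move=> e; rewrite clM; apply: clR; exact: lpa_sp.
- by move=> e; rewrite clM; apply: clR; exact: lpa_psstar.
- by move=> e; rewrite clM; apply: clR; exact: lpa_sstarp.
- move=> e f; rewrite clM cl0 (clR _ _ (lpa_sstars K e f)).
  by case: (e == f).
- move=> v vreg; rewrite (clR _ _ (lpa_CK K vreg)) clS big_map.
  by apply: eq_bigr => e _; rewrite clM.
- move=> P PP PS PT P0 PN PD PZ PM; elim/quotW.
  elim=> [[A|e|e]||t IH|t IHt u IHu|k t IH|t IHt u IHu].
  + exact: PP.
  + exact: PS.
  + exact: PT.
  + exact: P0.
  + by have := PN _ IH; rewrite clN.
  + by have := PD _ _ IHt IHu; rewrite clD.
  + by have := PZ k _ IH; rewrite clZ.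
  + by have := PM _ _ IHt IHu; rewrite clM.
Qed.

(** * Calculus of words in a Leavitt family *)

Section Family.
Local Open Scope ring_scope.
Variables (K : fieldType) (G : ultragraph) (L : nuAlgType K) (F : leavitt_family G L).
Implicit Types (A B : genset G) (v w : vertex G) (e f : edge G).
Implicit Types (a b c d : seq (edge G)) (x y z : L).

Local Notation p := (lf_p F).
Local Notation pv v := (lf_p F (gvertex v)).
Local Notation s := (lf_s F).
Local Notation st := (lf_sstar F).
Local Notation "x ** y" := (numul x y) (at level 40, left associativity).

Lemma p_set0 A : A `<=` set0 -> p A = 0.
Proof. by rewrite subset0 => A0; rewrite -(lf_p0 F); congr p; exact: genset_eq. Qed.

Lemma p_subl A B : A `<=` B -> p A ** p B = p A.
Proof. by move=> AB; rewrite lf_pI; congr p; apply: genset_eq; exact: setIidl. Qed.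

Lemma p_subr A B : A `<=` B -> p B ** p A = p A.
Proof. by move=> AB; rewrite lf_pI; congr p; apply: genset_eq; exact: setIidr. Qed.

Lemma p_disjoint A B : (forall v, gset A v -> gset B v -> False) -> p A ** p B = 0.
Proof. by move=> AB; rewrite lf_pI p_set0 // => v [/AB]. Qed.

Lemma p_s A e : p A ** s e = if `[< gset A (source e) >] then s e else 0.
Proof.
rewrite -{1}(lf_ps F) numulA; case: asboolP => Ae.
  by rewrite p_subr ?lf_ps // => _ ->.
by rewrite p_disjoint ?numul0x // => v Av /= ve; apply: Ae; rewrite -ve.
Qed.

Lemma st_p A e : st e ** p A = if `[< gset A (source e) >] then st e else 0.
Proof.
rewrite -{1}(lf_sstarp F) -numulA; case: asboolP => Ae.
  by rewrite p_subl ?lf_sstarp // => _ ->.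
by rewrite p_disjoint ?numulx0 // => v /= -> Av; exact: Ae.
Qed.

Lemma st_s e : st e ** s e = p (grange e).
Proof. by rewrite lf_sstars eqxx. Qed.

Lemma p_gseq (r : seq (vertex G)) : uniq r -> p (gseq r) = \sum_(v <- r) pv v.
Proof.
elim: r => [_|v r IH /= /andP[vr /IH {}IH]].
  by rewrite big_nil p_set0 //=; rewrite set_nil.
rewrite big_cons -IH.
have -> : gseq (v :: r) = gunion (gvertex v) (gseq r).
  by apply: genset_eq; exact: set_consE.
rewrite lf_pU -lf_pI p_disjoint ?subr0 // => w /= -> wr.
by rewrite wr in vr.
Qed.

Lemma finite_gseq A : finite_set A -> exists2 r, uniq r & A = gseq r.
Proof.
move=> /finite_seqP[r Ar]; exists (undup r); first exact: undup_uniq.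
by apply: genset_eq; rewrite Ar /=; apply/seteqP; split=> v /=; rewrite mem_undup.
Qed.

(* Paths act on the left: [sl a x] is s_a x and [stl a x] is s_a^* x; the
   algebra has no unit to stand for s_a when [a] is empty. *)
Definition sl a x := foldr (fun e y => s e ** y) x a.
Definition stl a x := foldl (fun y e => st e ** y) x a.

Lemma sl_cat a b x : sl (a ++ b) x = sl a (sl b x).
Proof. exact: foldr_cat. Qed.

Lemma slM a x y : sl a x ** y = sl a (x ** y).
Proof. by elim: a => //= e a IH; rewrite -numulA IH. Qed.

Lemma sl0 a : sl a 0 = 0.
Proof. by elim: a => //= e a ->; rewrite numulx0. Qed.

Lemma stl0 a : stl a 0 = 0.
Proof. by elim: a => //= e a IH; rewrite numulx0. Qed.

Lemma slD a x y : sl a (x + y) = sl a x + sl a y.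
Proof. by elim: a => //= e a ->; rewrite numulDr. Qed.

Lemma stlD a x y : stl a (x + y) = stl a x + stl a y.
Proof. by elim: a x y => //= e a IH x y; rewrite numulDr IH. Qed.

Lemma slZ a k x : sl a (k *: x) = k *: sl a x.
Proof. by elim: a => //= e a ->; rewrite numulZr. Qed.

Lemma stlZ a k x : stl a (k *: x) = k *: stl a x.
Proof. by elim: a x => //= e a IH x; rewrite numulZr IH. Qed.

Lemma sl_sum a T (r : seq T) (P : pred T) (f : T -> L) :
  sl a (\sum_(i <- r | P i) f i) = \sum_(i <- r | P i) sl a (f i).
Proof. by apply: (big_morph (sl a) (slD a)); exact: sl0. Qed.

Lemma stl_sum a T (r : seq T) (P : pred T) (f : T -> L) :
  stl a (\sum_(i <- r | P i) f i) = \sum_(i <- r | P i) stl a (f i).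
Proof. by apply: (big_morph (stl a) (stlD a)); exact: stl0. Qed.

(** Each s_e^* s_e collapses to p_{r(e)}, which the next edge of the path absorbs; only the last
    range survives. *)
Lemma stl_sl_cat e a b x : path (@follows G) e a ->
  stl (e :: a) (sl (e :: a ++ b) x) = p (grange (last e a)) ** sl b x.
Proof.
elim: a e => [|f a IH] e /=; first by move=> _; rewrite numulA st_s.
case/andP=> ef /IH <- /=; congr (stl a (st f ** _)).
by rewrite numulA st_s numulA p_s; move: ef; rewrite /follows => ->.
Qed.

(** Common initial edges cancel until two different edges meet, where s_e^* s_f = 0. The length
    bound keeps [b] from running out first. A projection left between edges fixes or kills what
    follows. *)
Lemma stl_sl_eq0 a b x : (size a <= size b)%N -> ~~ prefix a b -> stl a (sl b x) = 0.
Proof.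
elim: a b => [|e a IH] [|f b] //=; rewrite ltnS numulA lf_sstars.
case: (eqVneq e f) => [_|_ _ _]; last by rewrite numul0x stl0.
rewrite andTb => ab pab; case: a IH ab pab => [|e' a] IH; first by rewrite prefix0s.
case: b => // f' b ab pab.
have -> : p (grange e) ** sl (f' :: b) x =
    if `[< range e (source f') >] then sl (f' :: b) x else 0.
  by rewrite /= numulA p_s; case: asboolP; rewrite ?numul0x.
case: asboolP => _; last by rewrite stl0.
exact: IH.
Qed.

Definition path_into a A : Prop :=
  if a is e :: a' then path (@follows G) e a' /\ A `<=` range (last e a') else True.

Lemma path_into_rcons a A f : path_into a A -> gset A (source f) -> path_into (rcons a f) (grange f).
Proof.
case: a => [|e a] /=; first by split.
move=> [ea Ar] Af; rewrite last_rcons rcons_path ea /=; split=> //.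
by apply/asboolP; exact: Ar.
Qed.

Lemma sl_rcons a f x : sl (rcons a f) x = sl a (s f ** x).
Proof. by rewrite -cats1 sl_cat. Qed.

(** p_{r(e)} s_f = 0 unless s(f) lies in r(e), so a nonzero product comes from a path; the outer
    factors p_w fix its two ends. *)
Lemma cycle_of_neq0 w a : a != [::] -> pv w ** sl a (pv w) != 0 -> cycle_at w a.
Proof.
case: a => [|e a] // _.
have tail_neq0 : forall e, s e ** sl a (pv w) != 0 ->
    path (@follows G) e a /\ range (last e a) w.
  elim: a => [|f a IH] e' /=.
    rewrite -(lf_sp F e') -numulA => se; split=> //; apply: contrapT => Nw.
    by move: se; rewrite p_disjoint ?numulx0 ?eqxx // => v + /= vw; rewrite vw.
  move=> se; have : p (grange e') ** s f != 0.
    by apply: contra_neq se => pse; rewrite -(lf_sp F e') -numulA !(numulA (p _)) pse numul0x numulx0.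
  rewrite p_s; case: asboolP => [ef _|]; last by rewrite eqxx.
  have [|fa aw] := IH f; first by apply: contra_neq se => ->; rewrite numulx0.
  by split=> //; rewrite fa andbT; apply/asboolP.
move=> /=; rewrite numulA p_s; case: asboolP => [/= we|]; last by rewrite numul0x eqxx.
by move=> /tail_neq0[ea aw].
Qed.

End Family.

(** * First-return paths *)

Section FirstReturns.
Variable G : ultragraph.
Implicit Types (v w : vertex G) (a b c d z : seq (edge G)).

Lemma cycle_at_cat w c d : cycle_at w c -> cycle_at w d -> cycle_at w (c ++ d).
Proof.
case: c d => [|e c] [|f d] //= [ec ew cw] [fd fw dw]; rewrite last_cat cat_path ec /= fd.
by split=> //; rewrite andbT; apply/asboolP; rewrite fw.
Qed.

(** A later edge leaving [w] starts a tail that is a shorter cycle at [w]; hence induction on the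
    length. *)
Lemma exists_first_return w c : cycle_at w c -> exists d, first_return w d.
Proof.
have [n] := ubnP (size c); elim: n c => // n IH [//|e c]; rewrite ltnS => cn ecP.
have [/hasP[f /splitPr fc /eqP fw]|/hasPn Nw] := boolP (has (fun f => source f == w) c).
  case: fc cn ecP => c1 c2 cn ecP.
  case: ecP => + _; rewrite last_cat cat_path /= => /and3P[_ _ fc2] c2w.
  apply: (IH (f :: c2)) => //; apply: leq_trans cn.
  by rewrite /= size_cat /= addnS !ltnS leq_addl.
by exists (e :: c); split=> // f /Nw/eqP.
Qed.

Lemma cat_split (T : eqType) (a b x y : seq T) :
  a ++ x = b ++ y -> (size a <= size b)%N -> exists2 t, b = a ++ t & x = t ++ y.
Proof.
elim: a b => [|e a IH] [|f b] //= => [-> _|-> _|]; [by exists [::]|by exists (f :: b)|].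
by case=> -> /IH{}IH; rewrite ltnS => /IH[t -> ->]; exists t.
Qed.

Lemma iter_cat_inj (T : Type) n (c x y u : seq T) :
  iter n (cat c) x = iter n (cat c) y ++ u -> x = y ++ u.
Proof.
elim: n => //= n IH; rewrite -catA => /(congr1 (drop (size c))).
by rewrite !drop_size_cat.
Qed.

(* Since c and d are distinct first returns with c no longer than d, the word
   c^n d has no period a: it never matches its own shift by a. *)
Lemma first_return_no_period w c d n a f z u :
  first_return w c -> first_return w d -> c <> d -> (size c <= size d)%N ->
  a != [::] -> (size a <= n * size c)%N -> source f = w ->
  a ++ iter n (cat c) (f :: z) <> iter n (cat c) d ++ u.
Proof.
move=> cret dret cd cld; elim: n a f z => [|n IH] a f z a0 an fw.
  by move: an a0; rewrite mul0n leqn0 size_eq0 => ->.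
case: c => [|e c] in cret cd cld IH an *; first by case: cret.
have [[_ ew _] cNw] := cret; rewrite [iter n.+1 _ d]iterS -catA.
(* If [a] is shorter than [c], the first edge of [c], which leaves [w], reappears inside [c] beyond
   its first place. *)
have [ac|ca] := ltnP (size a) (size (e :: c)).
  move=> /cat_split /(_ (ltnW ac))[[|g t] ct]; last first.
    rewrite iterS /= => -[eg _]; case: (cNw g); last by rewrite -eg.
    by case: a ct a0 {an ac} => // h a [_ ->] _; rewrite mem_cat mem_head orbT.
  by move: ac; rewrite ct cats0 ltnn.
(* Otherwise [a] is [c] followed by [a']. If [a'] is nonempty, the induction applies with [e] as
   [f]; if it is empty, the copies of [c] cancel and [c] is a proper prefix of [d], whose next edge
   [f] leaves [w]. *)
move=> /esym/cat_split/(_ ca)[a' aE]; rewrite iterSr => /esym.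
case: (eqVneq a' [::]) aE => [-> _ /iter_cat_inj|a'0 aE]; last first.
  by apply: IH => //; rewrite -(leq_add2l (size (e :: c))) -mulSn -size_cat -aE.
case/cat_split => // -[|g t] dE; first by case: cd; rewrite dE cats0.
case=> fg _; have [_ dNw] := dret; case: (dNw g); last by rewrite -fg.
by rewrite dE /= mem_cat mem_head orbT.
Qed.

End FirstReturns.

(** * Vertices in a nonzero ideal *)

Section VertexInIdeal.
Local Open Scope ring_scope.
Variables (K : fieldType) (G : ultragraph) (L : nuAlgType K) (F : leavitt_family G L).
Hypothesis hK : condition_K G.
Variables (I : set L) (HI : two_sided_ideal I).
Implicit Types (A B : genset G) (v w : vertex G) (e f : edge G).
Implicit Types (a b c d : seq (edge G)) (x y z : L).

Local Notation p := (lf_p F).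
Local Notation pv v := (lf_p F (gvertex v)).
Local Notation s := (lf_s F).
Local Notation st := (lf_sstar F).
Local Notation sl := (sl F).
Local Notation stl := (stl F).
Local Notation "x ** y" := (numul x y) (at level 40, left associativity).

(** An ideal need not be stable under scalars here, but k^-1 p_A is an element of the algebra. *)
Lemma ideal_scaleK (k : K) A : k != 0 -> I (k *: p A) -> I (p A).
Proof.
move=> k0 /(idealMl HI (k^-1 *: p A)).
by rewrite numulZl numulZr scalerA mulVf // scale1r p_subl.
Qed.

Lemma ideal_stl a x : I x -> I (stl a x).
Proof. by elim: a x => //= e a IH x Ix; apply: IH; exact: idealMl. Qed.

Lemma pv_sl w a x : cycle_at w a -> pv w ** sl a x = sl a x.
Proof. by case: a => [|e a] //= [_ ew _]; rewrite numulA -ew lf_ps. Qed.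

Lemma stl_pv w a x : cycle_at w a -> stl a (pv w ** x) = stl a x.
Proof. by case: a => [|e a] //= [_ ew _]; rewrite numulA -ew lf_sstarp. Qed.

Lemma p_subl_vertex w A : gset A w -> p A ** pv w = pv w.
Proof. by move=> Aw; apply: p_subr => _ ->. Qed.

Lemma stl_sl_cycle w a : cycle_at w a -> stl a (sl a (pv w)) = pv w.
Proof.
case: a => [|e a] // [ea _ aw].
by rewrite -{2}[e :: a]cats0 [_ ++ _]/= stl_sl_cat //= p_subl_vertex.
Qed.

(* Two distinct first returns give a cycle g at w, longer than every path
   involved, with s_g^* s_a s_g = 0 for each of the finitely many a. *)
Lemma vertex_of_unit w (k0 : K) (l : seq (K * seq (edge G))) :
  k0 != 0 -> (forall t, t \in l -> t.2 != [::]) ->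
  I (pv w ** (k0 *: pv w + \sum_(t <- l) t.1 *: sl t.2 (pv w))) -> I (pv w).
Proof.
move=> k00 lP Iy; apply: (ideal_scaleK k00); case: (hK w) => [Nret|[c [d [cd cret dret]]]].
  move: Iy; rewrite numulDr numul_sumr big1_seq => [|t /andP[_ tl]].
    by rewrite addr0 numulZr p_subl.
  rewrite numulZr; case: (eqVneq (pv w ** sl t.2 (pv w)) 0) => [->|tn0].
    by rewrite scaler0.
  by have [b /Nret] := exists_first_return (cycle_of_neq0 (lP _ tl) tn0).
wlog cld : c d cd cret dret / (size c <= size d)%N.
  move=> wl; have [|/ltnW] := leqP (size c) (size d); first exact: wl.
  by apply: wl => // /esym.
(* Since [c] is nonempty, c^n is at least as long as every word of [l]. *)
pose n := (\max_(t <- l) size t.2)%N; pose g := iter n (cat c) d.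
have itw m : cycle_at w (iter m (cat c) d).
  by elim: m => [|m IH] /=; [case: dret|apply: cycle_at_cat IH; case: cret].
have gw := itw n : cycle_at w g.
(* This element is k0 p_w plus multiples of s_g^* s_a s_g p_w, which vanish unless [g] is a prefix
   of a g, that is, unless a is a period of [g]. *)
have := ideal_stl g (idealMr HI (sl g (pv w)) Iy); rewrite -numulA stl_pv //.
rewrite numulDl numulZl pv_sl // numul_suml stlD stlZ stl_sl_cycle //.
rewrite stl_sum big1_seq ?addr0 // => t /andP[_ tl].
rewrite numulZl stlZ slM pv_sl // -sl_cat stl_sl_eq0 ?scaler0 //.
  by rewrite size_cat leq_addl.
have c0 : (0 < size c)%N by case: (c) cret => // -[].
have [f [b [dE fw]]] : exists f b, d = f :: b /\ source f = w.
  by case: (d) dret => [[]//|f b] [[_ fw _] _]; exists f, b.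
apply/prefixP => -[u]; rewrite {1}/g {1}dE.
apply: (first_return_no_period (w := w)) => //; first exact: lP.
apply: leq_trans (leq_pmulr _ c0).
by rewrite /n (big_rem t) //= leq_maxl.
Qed.

(** For a shortest word a0 of [S], s_{a0}^* kills the words that do not extend a0 and turns a0 b
    into b, up to p_{r(a0)}, which p_w absorbs. As [S] has no repetitions, b is empty for a0 only,
    and [vertex_of_unit] applies. *)
Lemma vertex_of_real w (S : seq (seq (edge G))) (k : seq (edge G) -> K) :
  uniq S -> S != [::] -> (forall a, a \in S -> k a != 0 /\ path_into a (gvertex w)) ->
  I (\sum_(a <- S) k a *: sl a (pv w)) -> I (pv w).
Proof.
move=> uS S0 SP Iy.
have [a0 a0S a0min] : exists2 a0, a0 \in S & forall a, a \in S -> (size a0 <= size a)%N.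
  have exn : exists n, has (fun a => size a == n) S.
    by case: (S) S0 => // a S' _; exists (size a); rewrite /= eqxx.
  case: (ex_minnP exn) => n /hasP[a aS /eqP an] nmin; exists a => // b bS.
  by rewrite an; apply: nmin; apply/hasP; exists b.
have [ka0 a0w] := SP _ a0S.
have red b : pv w ** stl a0 (sl (a0 ++ b) (pv w)) = pv w ** sl b (pv w).
  case: a0 a0w {Iy a0S a0min ka0} => [|e a0] // [ea wa]; rewrite stl_sl_cat // numulA.
  by rewrite p_subl.
pose l := [seq (k a, drop (size a0) a) | a <- S & (a != a0) && prefix a0 a].
apply: (@vertex_of_unit w (k a0) l) => // [t /mapP[a]|].
  rewrite mem_filter => /andP[/andP[aa0 /prefixP[b ab]] _] -> /=.
  by apply: contra_neq aa0; rewrite ab drop_size_cat // => ->; rewrite cats0.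
have := idealMl HI (pv w) (ideal_stl a0 Iy); congr I.
rewrite (big_rem a0) //= stlD stlZ numulDr numulDr numulZr numulZr.
have /= red0 := red [::]; rewrite cats0 in red0; rewrite red0; congr (_ + _).
rewrite /l big_map big_filter rem_filter // big_filter stl_sum !numul_sumr.
rewrite big_mkcond [RHS]big_mkcond /=; apply: eq_big_seq => a aS.
case: eqP => //= _; rewrite stlZ !numulZr; case: ifP => [/prefixP[b ->]|Na].
  by rewrite red drop_size_cat.
by rewrite stl_sl_eq0 ?Na ?numulx0 ?scaler0 //; exact: a0min.
Qed.
End VertexInIdeal.

(** * Right truncation by finitely many edges *)

HB.instance Definition _ (G : ultragraph) := gen_eqMixin (genset G).

Section Truncation.
Local Open Scope ring_scope.
Variables (K : fieldType) (G : ultragraph) (L : nuAlgType K) (F : leavitt_family G L).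
Hypothesis no_sinks : forall v : vertex G, ~ is_sink v.
Variables (E : seq (edge G)) (uE : uniq E).
Implicit Types (A B C : genset G) (v w : vertex G) (e f : edge G).
Implicit Types (a b c d : seq (edge G)) (x y z : L).

Local Notation p := (lf_p F).
Local Notation pv v := (lf_p F (gvertex v)).
Local Notation s := (lf_s F).
Local Notation st := (lf_sstar F).
Local Notation sl := (sl F).
Local Notation "x ** y" := (numul x y) (at level 40, left associativity).

(** Right multiplication by 1 - sum_e s_e s_e^* over [E], expanded because the algebra may have no
    unit. *)
Definition trunc x := x - \sum_(e <- E) x ** s e ** st e.

Lemma trunc0 : trunc 0 = 0.
Proof. by rewrite /trunc big1 ?subr0 // => e _; rewrite !numul0x. Qed.

Lemma truncD x y : trunc (x + y) = trunc x + trunc y.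
Proof.
rewrite /trunc addrACA -opprD -big_split /=; congr (_ - _).
by apply: eq_bigr => e _; rewrite !numulDl.
Qed.

Lemma trunc_sum T (r : seq T) (P : pred T) (f : T -> L) :
  trunc (\sum_(i <- r | P i) f i) = \sum_(i <- r | P i) trunc (f i).
Proof. by apply: (big_morph trunc truncD); exact: trunc0. Qed.

Lemma truncM x y : trunc (x ** y) = x ** trunc y.
Proof.
rewrite /trunc numulBr numul_sumr; congr (_ - _).
by apply: eq_bigr => e _; rewrite !numulA.
Qed.

Lemma truncZ k x : trunc (k *: x) = k *: trunc x.
Proof.
rewrite /trunc scalerBr scaler_sumr; congr (_ - _).
by apply: eq_bigr => e _; rewrite !numulZl.
Qed.

Lemma trunc_sl a x : trunc (sl a x) = sl a (trunc x).
Proof. by elim: a => //= e a <-; rewrite truncM. Qed.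

Lemma trunc_s x f : f \notin E -> trunc x ** s f = x ** s f.
Proof.
move=> fE; rewrite /trunc numulBl numul_suml big1_seq ?subr0 // => e /andP[_ eE].
rewrite -numulA lf_sstars; case: eqP => [ef|]; last by rewrite numulx0.
by rewrite ef (negbTE fE) in eE.
Qed.

(** As [E] is finite and [v] is no sink, [v] is regular, and p_v is a sum of s_e s_e^* with all e in
    [E]. *)
Lemma trunc_vertex v : (forall e, source e = v -> e \in E) -> trunc (pv v) = 0.
Proof.
move=> vE; have vfin : finite_set (source @^-1` [set v]).
  by apply: (@sub_finite_set _ _ [set` E]) => // e /vE.
have vreg : regular v by split=> //; apply/set0P/eqP; exact: no_sinks.
apply/eqP; rewrite subr_eq0 {1}(lf_CK F vreg); apply/eqP.
transitivity (\sum_(e <- E | source e == v) s e ** st e); last first.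
  rewrite big_mkcond /=; apply: eq_bigr => e _.
  rewrite p_s; case: asboolP => /= [->|ev]; first by rewrite eqxx.
  by case: eqP => [/ev//|_]; rewrite numul0x.
rewrite -[RHS]big_filter; apply: perm_big; apply: uniq_perm => //.
  by rewrite filter_uniq.
move=> e; rewrite in_fset_set // mem_filter; apply/idP/andP => [|[/eqP ev _]].
  by rewrite inE /= => ev; rewrite ev eqxx vE.
by rewrite inE.
Qed.

(** The difference stands for the projection of A \ B, which need not be a generalized vertex. Each
    vertex of A \ B emits an edge, necessarily in [E]; so A \ B is finite and the difference is a
    sum of p_v of truncation 0. *)
Lemma trunc_diff A B :
  (forall e, gset A (source e) -> ~ gset B (source e) -> e \in E) ->
  trunc (p A - p (ginter A B)) = 0.
Proof.
move=> ABE; have : finite_set (A `\` B).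
  apply: (@sub_finite_set _ _ (source @` [set` E])); last exact: finite_image.
  move=> v [Av Bv]; have [e ev] : source @^-1` [set v] !=set0.
    by apply/set0P/eqP; exact: no_sinks.
  by exists e => //=; apply: ABE; rewrite ev.
case/finite_seqP => r0 ABr0; have [r ur ABr] : exists2 r, uniq r & A `\` B = [set` r].
  exists (undup r0); first exact: undup_uniq.
  by rewrite ABr0; apply/seteqP; split=> v /=; rewrite mem_undup.
have AE : A = gunion (ginter A B) (gseq r).
  by apply: genset_eq; rewrite /= -ABr; exact/esym/setUIDK.
rewrite {1}AE lf_pU [p (ginter (ginter _ _) _)]p_set0; last first.
  by move=> v [[_ Bv]] /=; rewrite -/([set` r] v) -ABr => -[].
rewrite subr0 addrC addKr p_gseq // trunc_sum big1_seq // => v /andP[_ vr].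
have [Av Bv] : (A `\` B) v by rewrite ABr.
by apply: trunc_vertex => e ev; apply: ABE; rewrite ev.
Qed.

(** Splits A \ B into its parts inside and outside C; p_C fixes the first ([diffIl]) and kills the
    second ([diffUr]). *)
Lemma diff_split A B C : p A - p (ginter A B) =
  (p (ginter A C) - p (ginter (ginter A C) B)) + (p A - p (ginter A (gunion B C))).
Proof.
have -> : ginter A (gunion B C) = gunion (ginter A B) (ginter A C).
  by apply: genset_eq; exact: setIUr.
rewrite lf_pU; have -> : ginter (ginter A C) B = ginter (ginter A B) (ginter A C).
  apply: genset_eq => /=; apply/seteqP; split=> v /=; tauto.
rewrite -(addrA (p (ginter A B))); set t := (p (ginter A C) - _).
by rewrite opprD (addrCA t) (addrCA t) subrr addr0.
Qed.

Lemma diffIl A B C : p C ** (p (ginter A C) - p (ginter (ginter A C) B)) =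
  p (ginter A C) - p (ginter (ginter A C) B).
Proof. by rewrite numulBr !p_subr //= => v [] // []. Qed.

Lemma diffUr A B C : p C ** (p A - p (ginter A (gunion B C))) = 0.
Proof.
rewrite numulBr !lf_pI; apply/eqP; rewrite subr_eq0; apply/eqP; congr p.
apply: genset_eq => /=; apply/seteqP; split=> v /=; tauto.
Qed.

(* Splitting A \ B successively along the sets of the list decomposes it into
   atoms, on each of which the combination is a scalar. *)
Lemma trunc_diff_neq0 (l : seq (K * genset G)) (k : K) A B :
  trunc (k *: (p A - p (ginter A B)) +
         \sum_(t <- l) t.1 *: (p t.2 ** (p A - p (ginter A B)))) != 0 ->
  exists f, [/\ f \notin E, gset A (source f), ~ gset B (source f) &
    k + \sum_(t <- l | `[< gset t.2 (source f) >]) t.1 != 0].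
Proof.
elim: l k A B => [|[k1 C] l IH] k A B.
  rewrite big_nil addr0 truncZ => T0.
  have k0 : k != 0 by apply: contra_neq T0 => ->; rewrite scale0r.
  apply: contrapT => Nf; move: T0; rewrite trunc_diff ?scaler0 ?eqxx // => e Ae Be.
  by apply: contrapT => /negP eE; apply: Nf; exists e; rewrite big_nil addr0.
rewrite big_cons (diff_split A B C).
(* p_C acts as 1 on [q1] and as 0 on [q2]: the scalar becomes k + k1 inside C and stays k
   outside. *)
set q1 := (p (ginter A C) - _); set q2 := (p A - _).
have -> : k *: (q1 + q2) + ((k1, C).1 *: (p (k1, C).2 ** (q1 + q2)) +
      \sum_(t <- l) t.1 *: (p t.2 ** (q1 + q2))) =
    ((k + k1) *: q1 + \sum_(t <- l) t.1 *: (p t.2 ** q1)) +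
    (k *: q2 + \sum_(t <- l) t.1 *: (p t.2 ** q2)).
  rewrite /= [p C ** _]numulDr diffIl diffUr addr0 scalerDr scalerDl.
  under eq_bigr do rewrite numulDr scalerDr.
  by rewrite -/q1 big_split /= [k1 *: _ + _]addrA addrACA -[in RHS](addrA (k *: q1)).
rewrite truncD; set z1 := trunc _; have [->|z10 _] := eqVneq z1 0.
  rewrite add0r => /IH[f [fE Af BCf sf]]; exists f; split=> //; first by move=> Bf; apply: BCf; left.
  by rewrite big_cons; case: asboolP => // Cf; case: BCf; right.
have [f [fE [Af Cf] Bf sf]] := IH _ _ _ z10; exists f; split=> //.
by rewrite big_cons /= asboolT // addrA.
Qed.

(** Case of [trunc_diff_neq0] with A the union of all the sets, B empty and initial scalar 0. The
    nonzero sum is the scalar by which the combination acts on s_f. *)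
Lemma trunc_comb_neq0 (l : seq (K * genset G)) :
  trunc (\sum_(t <- l) t.1 *: p t.2) != 0 ->
  exists2 f, f \notin E & \sum_(t <- l | `[< gset t.2 (source f) >]) t.1 != 0.
Proof.
move=> l0; pose A := foldr (fun t => gunion t.2) (gempty G) l.
have lA t : t \in l -> gset t.2 `<=` A.
  rewrite /A; elim: l {l0 A} => // u l IH; rewrite inE => /predU1P[->|/IH{}IH] v tv /=.
    by left.
  by right; exact: IH.
have [|f [fE _ _]] := @trunc_diff_neq0 l 0 A (gempty G); last by rewrite add0r; exists f.
move: l0; congr (trunc _ != 0); rewrite scale0r add0r.
apply: eq_big_seq => t /lA tA; congr (_ *: _).
by rewrite [p (ginter _ _)]p_set0 ?subr0 ?p_subl // => v [].
Qed.

End Truncation.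

(** * Ghost degree and its reduction *)

Section GhostDegree.
Local Open Scope ring_scope.
Variables (K : fieldType) (G : ultragraph) (L : nuAlgType K) (F : leavitt_family G L).
Implicit Types (A B C : genset G) (v w : vertex G) (e f : edge G).
Implicit Types (a b c d : seq (edge G)) (x y z : L).

Local Notation p := (lf_p F).
Local Notation pv v := (lf_p F (gvertex v)).
Local Notation s := (lf_s F).
Local Notation st := (lf_sstar F).
Local Notation sl := (sl F).
Local Notation "x ** y" := (numul x y) (at level 40, left associativity).

Definition real_element x := exists l : seq (K * seq (edge G) * genset G),
  (forall t, t \in l -> path_into t.1.2 t.2) /\ x = \sum_(t <- l) t.1.1 *: sl t.1.2 (p t.2).

Lemma real0 : real_element 0.
Proof. by exists [::]; rewrite big_nil. Qed.

Lemma realD x y : real_element x -> real_element y -> real_element (x + y).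
Proof.
move=> [l [lP ->]] [m [mP ->]]; exists (l ++ m); rewrite big_cat; split=> // t.
by rewrite mem_cat => /orP[/lP|/mP].
Qed.

Lemma realZ k x : real_element x -> real_element (k *: x).
Proof.
move=> [l [lP ->]]; exists [seq (k * t.1.1, t.1.2, t.2) | t <- l]; split.
  by move=> _ /mapP[t /lP tP ->].
by rewrite scaler_sumr big_map; apply: eq_bigr => t _; rewrite scalerA.
Qed.

Lemma path_into_sub a A B : B `<=` A -> path_into a A -> path_into a B.
Proof. by case: a => [//|e a] BA [ea Ar]; split=> //; exact: subset_trans Ar. Qed.

Lemma real_p x A : real_element x -> real_element (x ** p A).
Proof.
move=> [l [lP ->]]; exists [seq (t.1, ginter t.2 A) | t <- l]; split.
  by move=> _ /mapP[t /lP tP ->]; apply: path_into_sub tP => v [].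
by rewrite numul_suml big_map; apply: eq_bigr => t _; rewrite numulZl slM lf_pI.
Qed.

Lemma real_s x f : real_element x -> real_element (x ** s f).
Proof.
move=> [l [lP ->]].
exists [seq (t.1.1, rcons t.1.2 f, grange f) | t <- l & `[< gset t.2 (source f) >]]; split.
  move=> _ /mapP[t + ->]; rewrite mem_filter => /andP[/asboolP tf /lP tP] /=.
  exact: path_into_rcons tP tf.
rewrite numul_suml big_map big_filter [RHS]big_mkcond; apply: eq_bigr => t _ /=.
rewrite numulZl slM p_s; case: asboolP => _; last by rewrite sl0 scaler0.
by rewrite sl_rcons lf_sp.
Qed.

(* x is a combination of terms s_a p_A s_b^* with b of length at most n. *)
Fixpoint ghost n x : Prop :=
  if n is n'.+1 then
    exists (E : seq (edge G)) (xs : edge G -> L) (x' : L),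
      [/\ uniq E, forall e, ghost n' (xs e), real_element x' &
          x = \sum_(e <- E) xs e ** st e + x']
  else real_element x.

Lemma real_ghost n x : real_element x -> ghost n x.
Proof.
elim: n x => // n IH x rx; exists [::], (fun=> 0), x; split=> //.
  by move=> e; apply: IH; exact: real0.
by rewrite big_nil add0r.
Qed.

Lemma ghostS n x : ghost n x -> ghost n.+1 x.
Proof.
elim: n x => [x|n IH x [E [xs [x' [uE xsP rx' ->]]]]]; first exact: (@real_ghost 1%N).
by exists E, xs, x'; split=> // e; exact: (IH _ (xsP e)).
Qed.

Lemma ghost_leq m n x : (m <= n)%N -> ghost m x -> ghost n x.
Proof.
move=> /subnK <-; elim: (n - m)%N => // i IH /IH; rewrite addSn; exact: ghostS.
Qed.

Lemma sum_widen (T : eqType) (r r' : seq T) (f : T -> L) :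
  uniq r -> uniq r' -> {subset r <= r'} ->
  \sum_(i <- r) f i = \sum_(i <- r') if i \in r then f i else 0.
Proof.
move=> ur ur' rr'; rewrite -big_mkcond -[RHS]big_filter; apply: perm_big.
apply: uniq_perm => //; first by rewrite filter_uniq.
by move=> i; rewrite mem_filter; case: (boolP (i \in r)) => // /rr' ->.
Qed.

Lemma ghostD n x y : ghost n x -> ghost n y -> ghost n (x + y).
Proof.
elim: n x y => [|n IH] x y; first exact: realD.
move=> [E [xs [x' [uE xsP rx' ->]]]] [D [ys [y' [uD ysP ry' ->]]]].
exists (undup (E ++ D)), (fun e => (if e \in E then xs e else 0) + (if e \in D then ys e else 0)).
exists (x' + y'); split; [exact: undup_uniq| |exact: realD|].
  have g0 := real_ghost n real0.
  by move=> e; apply: IH; case: ifP => _ //; [exact: xsP|exact: ysP].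
rewrite addrACA; congr (_ + _); under [RHS]eq_bigr do rewrite numulDl.
rewrite big_split /=; congr (_ + _).
  rewrite (@sum_widen _ E (undup (E ++ D))) ?undup_uniq //.
    by apply: eq_bigr => e _; case: ifP; rewrite ?numul0x.
  by move=> e eE; rewrite mem_undup mem_cat eE.
rewrite (@sum_widen _ D (undup (E ++ D))) ?undup_uniq //.
  by apply: eq_bigr => e _; case: ifP; rewrite ?numul0x.
by move=> e eE; rewrite mem_undup mem_cat eE orbT.
Qed.

Lemma ghostZ n k x : ghost n x -> ghost n (k *: x).
Proof.
elim: n x => [|n IH] x; first exact: realZ.
move=> [E [xs [x' [uE xsP rx' ->]]]].
exists E, (fun e => k *: xs e), (k *: x'); split=> //; [by move=> e; exact: (IH _ (xsP e))|exact: realZ|].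
by rewrite scalerDr scaler_sumr; congr (_ + _); apply: eq_bigr => e _; rewrite numulZl.
Qed.

Lemma ghost_p n x A : ghost n x -> ghost n (x ** p A).
Proof.
case: n => [|n]; first exact: real_p.
move=> [E [xs [x' [uE xsP rx' ->]]]].
exists E, (fun e => if `[< gset A (source e) >] then xs e else 0), (x' ** p A).
split=> //; [by move=> e; case: ifP => _; [exact: xsP|apply: real_ghost; exact: real0]|exact: real_p|].
rewrite numulDl numul_suml; congr (_ + _); apply: eq_bigr => e _.
by rewrite -numulA st_p; case: ifP => _; rewrite ?numul0x ?numulx0.
Qed.

(** Of the ghost terms only that of s_f^* survives, in degree one less; the real part stays real. In
    degree 0 nothing is lowered, since [0.-1] is 0. *)
Lemma ghost_s n x f : ghost n x -> ghost n.-1 (x ** s f).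
Proof.
case: n => [|n]; first exact: real_s.
move=> [E [xs [x' [uE xsP rx' ->]]]]; rewrite numulDl; apply: ghostD; last first.
  by apply: real_ghost; exact: real_s.
rewrite numul_suml (eq_bigr (fun e => if e == f then xs f ** p (grange f) else 0)).
  rewrite -big_mkcond big_const_seq.
  by elim: (count _ _) => /= [|m IH]; [apply: real_ghost; exact: real0|
     apply: ghostD IH; apply: ghost_p; exact: xsP].
by move=> e _; rewrite -numulA lf_sstars; case: eqP => [->//|_]; rewrite numulx0.
Qed.

Lemma ghost_st n x f : ghost n x -> ghost n.+1 (x ** st f).
Proof.
move=> nx; exists [:: f], (fun=> x), 0; split=> //; first exact: real0.
by rewrite big_seq1 addr0.
Qed.

Lemma exists_ghost x : exists n, ghost n x.
Proof.
have GD y z : (exists n, ghost n y) -> (exists n, ghost n z) -> exists n, ghost n (y + z).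
  move=> [n ny] [m mz]; exists (maxn n m); apply: ghostD.
    by apply: ghost_leq ny; exact: leq_maxl.
  by apply: ghost_leq mz; exact: leq_maxr.
have G0 : exists n, ghost n 0 by exists 0%N; exact: real0.
have GZ k y : (exists n, ghost n y) -> exists n, ghost n (k *: y).
  by move=> [n ny]; exists n; exact: ghostZ.
(* Quantifying over [z] after [y] lets the induction on [y] treat a product one factor at a time. *)
have GM y : forall z, (exists n, ghost n z) -> exists n, ghost n (z ** y).
  elim/(@lf_ind _ _ _ F): y => [A|e|e||y IH|y y' IH IH'|k y IH|y y' IH IH'] z zP.
  - by case: zP => n /ghost_p zA; exists n.
  - by case: zP => n /ghost_s ze; exists n.-1.
  - by case: zP => n /ghost_st ze; exists n.+1.
  - by rewrite numulx0.
  - by rewrite numulxN -scaleN1r; apply: GZ; exact: IH.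
  - by rewrite numulDr; apply: GD; [exact: IH|exact: IH'].
  - by rewrite numulZr; apply: GZ; exact: IH.
  - by rewrite numulA; apply: IH'; exact: IH.
have Gp A : exists n, ghost n (p A).
  exists 0%N, [:: (1, [::], A)]; split; first by move=> t; rewrite inE => /eqP ->.
  by rewrite big_seq1 /= scale1r.
elim/(@lf_ind _ _ _ F): x => [A|e|e||y IH|y y' IH IH'|k y IH|y y' IH _] //.
- by rewrite -(lf_ps F); apply: GM.
- by rewrite -(lf_psstar F); apply: GM.
- by rewrite -scaleN1r; exact: GZ.
- exact: GD.
- exact: GZ.
- exact: GM.
Qed.

Hypothesis no_sinks : forall v : vertex G, ~ is_sink v.
Hypothesis hK : condition_K G.
Variables (I : set L) (HI : two_sided_ideal I).

(** Collecting terms by path gives x = sum_a s_a y_a, where y_a combines projections. Truncation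
    acts on the y_a alone, so some y_{a0} has nonzero truncation and yields f outside [E] with
    k_{a0} <> 0, where y_a s_f = k_a s_f. Multiplying by s_f p_w, with w in r(f), leaves a
    combination of the distinct paths a f. *)
Lemma vertex_of_trunc_real (E : seq (edge G)) x : uniq E -> real_element x ->
  trunc F E x != 0 -> I (trunc F E x) -> exists w, I (pv w).
Proof.
move=> uE [l [lP xE]] Tx IT.
pose U := undup [seq t.1.2 | t <- l].
pose y a := \sum_(t <- l | t.1.2 == a) t.1.1 *: p t.2.
have {}xE : x = \sum_(a <- U) sl a (y a).
  rewrite xE; under [RHS]eq_bigr do rewrite sl_sum.
  rewrite (exchange_big_dep xpredT) //=; apply: eq_big_seq => t tl.
  rewrite (big_rem t.1.2) ?eqxx /=; last by rewrite mem_undup; apply/mapP; exists t.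
  rewrite slZ big1_seq ?addr0 // => a /andP[/eqP <-].
  by rewrite mem_rem_uniqF ?undup_uniq.
have [a0 a0U Ta0] : exists2 a, a \in U & trunc F E (y a) != 0.
  apply: contrapT => Na; move: Tx; rewrite xE trunc_sum big1_seq ?eqxx // => a /andP[_ aU].
  rewrite trunc_sl (_ : trunc F E (y a) = 0) ?sl0 //.
  by apply/eqP/negPn/negP => ya; apply: Na; exists a.
have yE a : y a = \sum_(t <- [seq (t.1.1, t.2) | t <- l & t.1.2 == a]) t.1 *: p t.2.
  by rewrite big_map big_filter.
move: (Ta0); rewrite yE => /trunc_comb_neq0 -/(_ no_sinks uE)[f fE].
pose k a := \sum_(t <- l | (t.1.2 == a) && `[< gset t.2 (source f) >]) t.1.1.
rewrite big_map big_filter_cond -/(k a0) => ka0.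
have ys a : y a ** s f = k a *: s f.
  rewrite numul_suml /k scaler_suml big_mkcond [RHS]big_mkcond.
  apply: eq_bigr => t _; rewrite numulZl p_s; case: (_ == a) => //=.
  by case: ifP; rewrite ?scaler0.
have [w fw] := range_nonempty f; exists w.
pose S := [seq rcons a f | a <- U & k a != 0].
(* Every word of [S] ends in [f]; dropping that edge recovers the a whose coefficient is k_a. *)
apply: (vertex_of_real (F := F) hK HI (S := S) (k := fun b => k (take (size b).-1 b))).
- by rewrite map_inj_uniq ?filter_uniq ?undup_uniq // => a b /rcons_inj[].
- by rewrite -size_eq0 size_map size_eq0 -has_filter; apply/hasP; exists a0.
- have tk a : take (size (rcons a f)).-1 (rcons a f) = a.
    by rewrite size_rcons -cats1 take_size_cat.
  move=> b /mapP[a]; rewrite mem_filter => /andP[ka aU] ->; rewrite tk; split=> //.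
  have [t [tl ta tf]] : exists t, [/\ t \in l, t.1.2 = a & gset t.2 (source f)].
    apply: contrapT => Nt; move: ka; rewrite /k big1_seq ?eqxx //.
    by move=> t /andP[/andP[/eqP ta /asboolP tf] tl]; case: Nt; exists t.
  apply: (@path_into_sub _ (grange f)); first by move=> _ ->.
  by apply: path_into_rcons tf; rewrite -ta; exact: lP.
have := idealMr HI (pv w) (idealMr HI (s f) IT); congr I.
rewrite trunc_s // xE !numul_suml big_map big_filter [RHS]big_mkcond.
apply: eq_bigr => a _; rewrite !slM ys numulZl slZ sl_rcons.
rewrite size_rcons -cats1 take_size_cat //.
by case: eqP => //= ->; rewrite scale0r.
Qed.

(** Induction on a bound for the ghost degree, lowered by any f with x s_f <> 0. If there is none, x
    s_e = 0 forces each ghost term to be - x' s_e s_e^*, so x is the truncation of its real part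
    x'. *)
Lemma vertex_of_ideal x : I x -> x != 0 -> exists w, I (pv w).
Proof.
have [n] := exists_ghost x; elim: n x => [|n IH] x nx Ix x0.
  have Tx : trunc F [::] x = x by rewrite /trunc big_nil subr0.
  by apply: (@vertex_of_trunc_real [::] x) nx _ _; rewrite ?Tx.
have [E [xs [x' [uE xsP rx' xE]]]] := nx.
have [[f xf]|Nf] := EM (exists f, x ** s f != 0).
  by apply: (IH _ (ghost_s f nx) _ xf); exact: idealMr.
suff xT : x = trunc F E x' by apply: (@vertex_of_trunc_real E x') => //; rewrite -xT.
rewrite {1}xE /trunc addrC; congr (_ + _); rewrite -sumrN; apply: eq_big_seq => e eE.
have : x ** s e = 0 by apply/eqP/negPn/negP => xe; apply: Nf; exists e.
rewrite xE numulDl numul_suml (big_rem e) //= -numulA st_s.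
rewrite [X in _ + X + _]big1_seq => [|f /andP[_ fE]].
  rewrite addr0 => /eqP; rewrite addr_eq0 => /eqP xe.
  by rewrite -{1}(lf_psstar F e) numulA xe numulNx.
rewrite -numulA lf_sstars; case: eqP => [fe|_]; last by rewrite numulx0.
by move: fE; rewrite fe mem_rem_uniqF.
Qed.

End GhostDegree.

(** * The ideal generated by a vertex *)

Section VertexGeneratesAll.
Local Open Scope ring_scope.
Variables (K : fieldType) (G : ultragraph) (L : nuAlgType K) (F : leavitt_family G L).
Hypothesis no_sinks : forall v : vertex G, ~ is_sink v.
Hypothesis hconn : forall (v : vertex G) (q : nat -> edge G), infinite_path q -> connects v q.
Hypothesis hemit : forall A : genset G, infinite_emitter A ->
  forall v : vertex G, exists alpha : fin_path G,
    psource alpha = [set v] /\ A `<=` prange alpha.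
Variables (I : set L) (HI : two_sided_ideal I).
Implicit Types (A B : genset G) (v w : vertex G) (e f : edge G) (x y : L).

Local Notation p := (lf_p F).
Local Notation pv v := (lf_p F (gvertex v)).
Local Notation s := (lf_s F).
Local Notation st := (lf_sstar F).
Local Notation "x ** y" := (numul x y) (at level 40, left associativity).

Lemma ideal_p_sub A B : A `<=` B -> I (p B) -> I (p A).
Proof. by move=> AB /(idealMl HI (p A)); rewrite p_subl. Qed.

Lemma ideal_range e : I (pv (source e)) -> I (p (grange e)).
Proof.
by move=> /(idealMl HI (st e)) /(idealMr HI (s e)); rewrite lf_sstarp st_s.
Qed.

(** Membership spreads along the path: from p_{s(e)} to p_{r(e)} = s_e^* p_{s(e)} s_e, and from
    there to the source of the next edge. *)
Lemma ideal_prange v (alpha : fin_path G) A :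
  I (pv v) -> psource alpha = [set v] -> A `<=` prange alpha -> I (p A).
Proof.
case: alpha => [B|e es ees] /= Iv => [Bv AB|/seteqP[ev _] Ar].
  by apply: ideal_p_sub Iv; rewrite /= -Bv.
apply: (@ideal_p_sub _ (grange (last e es))) => //.
have {ev} : I (p (grange e)) by apply: ideal_range; rewrite (ev (source e)).
elim: es e ees {Ar} => //= f es IH e /andP[/asboolP ef fes] Ie.
by apply: IH => //; apply: ideal_range; apply: ideal_p_sub Ie => _ ->.
Qed.

(** If A were an infinite emitter, [hemit] would put p_A in [I]. So A emits finitely many edges, is
    finite for lack of sinks, and p_A is the sum of its p_w. *)
Lemma vertex_notin_ideal v A : I (pv v) -> ~ I (p A) -> exists2 w, gset A w & ~ I (pv w).
Proof.
move=> Iv NA; apply: contrapT => Nw; apply: NA.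
have [/hemit/(_ v)[alpha []]|/contrapT Afin] := EM (infinite_emitter A).
  exact: ideal_prange.
have : finite_set A.
  apply: (@sub_finite_set _ _ (source @` (source @^-1` (A : set _)))); last exact: finite_image.
  move=> w Aw; have [e ew] : source @^-1` [set w] !=set0.
    by apply/set0P/eqP; exact: no_sinks.
  by exists e => //=; rewrite ew.
move=> /finite_gseq[r ur AE]; rewrite AE p_gseq //.
rewrite big_seq_cond; apply: ideal_sum => // w; rewrite andbT => wr.
by apply: contrapT => NI; apply: Nw; exists w => //; rewrite AE.
Qed.

(** By [hemit] again, [w] is regular, and p_w is the sum of the s_e p_{r(e)} s_e^*. *)
Lemma edge_notin_ideal v w : I (pv v) -> ~ I (pv w) ->
  exists2 e, source e = w & ~ I (p (grange e)).
Proof.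
move=> Iv Nw; apply: contrapT => Ne; apply: Nw.
have [/hemit/(_ v)[alpha []]|/contrapT wfin] := EM (infinite_emitter (gvertex w)).
  exact: ideal_prange.
have wreg : regular w by split=> //; apply/set0P/eqP; exact: no_sinks.
rewrite (lf_CK F wreg) big_seq_cond; apply: ideal_sum => // e; rewrite andbT.
rewrite in_fset_set // inE /= => ew.
have : I (p (grange e)) by apply: contrapT => NI; apply: Ne; exists e.
by move=> /(idealMl HI (s e)) /(idealMr HI (st e)); rewrite lf_sp.
Qed.

Lemma all_p_in_ideal v A : I (pv v) -> I (p A).
Proof.
move=> Iv; apply: contrapT => NA.
have step B : ~ I (p B) -> exists e, gset B (source e) /\ ~ I (p (grange e)).
  move=> /(vertex_notin_ideal Iv)[w Bw /(edge_notin_ideal Iv)[e ew Ne]].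
  by exists e; rewrite ew.
(* If p_{r(e)} is in [I], the successor e is a mere default. *)
have /choice[nxt nxtP] e : exists f,
    ~ I (p (grange e)) -> range e (source f) /\ ~ I (p (grange f)).
  have [Ie|/step[f fP]] := EM (I (p (grange e))); first by exists e.
  by exists f.
have [e0 [_ Ne0]] := step A NA.
have NI i : ~ I (p (grange (iter i nxt e0))).
  by elim: i => //= i /nxtP[].
have [|i [alpha [av ai]]] := @hconn v (fun i => iter i nxt e0).
  by move=> i; have [] := nxtP _ (NI i).
(* [v] reaches the source of the i-th edge, so [I] contains the projection of that source and then
   that of the range. *)
by apply: (NI i); apply: ideal_range; apply: ideal_prange Iv av _ => _ ->.
Qed.

Lemma ideal_setT v : I (pv v) -> I = setT.
Proof.
move=> Iv; have Ip A := @all_p_in_ideal v A Iv.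
apply/seteqP; split=> // x _.
(* The scaling case of the induction needs all multiples at once, since [I] is not assumed stable
   under scalars. *)
suff IZ : forall k : K, I (k *: x) by rewrite -(scale1r x); exact: IZ.
elim/(@lf_ind _ _ _ F): x => [A|e|e||x IH|x y IHx IHy|k x IH|x y IH _] l.
- have <- : p A ** p A = p A by rewrite p_subl.
  by rewrite -numulZl; exact: idealMl.
- by rewrite -(lf_ps F) -numulZr; exact: idealMr.
- by rewrite -(lf_psstar F) -numulZr; exact: idealMr.
- by rewrite scaler0; exact: ideal0.
- by rewrite scalerN; exact: idealN.
- by rewrite scalerDr; exact: idealD.
- by rewrite scalerA.
- by rewrite -numulZl; exact: idealMr.
Qed.

End VertexGeneratesAll.

Theorem theorem4p13 (K : fieldType) (G : ultragraph)
  (no_sinks : forall v : vertex G, ~ is_sink v)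
  (hK : condition_K G)
  (hconn : forall (v : vertex G) (p : nat -> edge G),
     infinite_path p -> connects v p)
  (hemit : forall A : genset G, infinite_emitter A ->
     forall v : vertex G, exists alpha : fin_path G,
       psource alpha = [set v] /\ A `<=` prange alpha) :
  simple_algebra (leavitt K G).
Proof.
move=> I HI; pose F := leavitt_canonical_family K G.
have [[x [Ix x0]]|N] := EM (exists x, I x /\ x != 0%R); [right|left].
  have [w] := vertex_of_ideal F no_sinks hK HI Ix x0.
  exact: (ideal_setT no_sinks hconn hemit HI).
apply/seteqP; split=> [x Ix|_ ->]; last exact: ideal0.
by apply/eqP/negPn/negP => x0; apply: N; exists x.
Qed.
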